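(* Let $X$ be a set, let $k,\ell$ be kernels on $X$ and let $s$ be a normalized complete Nevanlinna--Pick kernel on $X$. Let $\mathcal{E}$ be a Hilbert space and let $\mathcal{M} \subset \mathcal{H}_k \otimes \mathcal{E}$ and $\mathcal{N} \subset \mathcal{H}_\ell \otimes \mathcal{E}$ be two non-zero closed subspaces such that $\mathcal{N}$ is contractively contained in $\mathcal{M}$. If $\mathcal{F},\mathcal{G}$ are Hilbert spaces and $\Phi \in \operatorname{Mult}(\mathcal{H}_s \otimes \mathcal{F}, \mathcal{H}_k \otimes \mathcal{E})$ and $\Psi \in \operatorname{Mult}(\mathcal{H}_s \otimes \mathcal{G}, \mathcal{H}_\ell \otimes \mathcal{E})$ are partially isometric multipliers with $\mathcal{M} = \Phi \cdot (\mathcal{H}_s \otimes \mathcal{F})$ and $\mathcal{N} = \Psi \cdot (\mathcal{H}_s \otimes \mathcal{G})$, then there exists a contractive multiplier $\Gamma \in \operatorname{Mult}(\mathcal{H}_s \otimes \mathcal{G}, \mathcal{H}_s \otimes \mathcal{F})$ with $\Psi = \Phi \Gamma$.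
   Context: All Hilbert spaces are complex. A kernel on a set $X$ is a positive semi-definite function $k : X \times X \to \mathbb{C}$, i.e. the matrix $[k(x_i,x_j)]$ is positive semi-definite for every finite subset $\{x_1,\dots,x_n\} \subset X$; this is written $k \ge 0$. $\mathcal{H}_k$ denotes the reproducing kernel Hilbert space on $X$ with kernel $k$, so $\langle f, k(\cdot,x)\rangle = f(x)$ for $f \in \mathcal{H}_k$, $x \in X$. A kernel $s$ is normalized if there is $x_0 \in X$ with $s(x,x_0) = 1$ for all $x \in X$. A normalized kernel $s$ is a complete Nevanlinna--Pick kernel if and only if $s$ is non-vanishing and $1 - 1/s \ge 0$ (this may be taken as the definition), where $1/s$ is the pointwise reciprocal on $X \times X$. For a Hilbert space $\mathcal{E}$, elements of $\mathcal{H}_k \otimes \mathcal{E}$ are regarded as $\mathcal{E}$-valued functions on $X$. For kernels $\ell, k$ on $X$ and Hilbert spaces $\mathcal{F}, \mathcal{E}$, $\operatorname{Mult}(\mathcal{H}_\ell \otimes \mathcal{F}, \mathcal{H}_k \otimes \mathcal{E})$ is the space of functions $\Phi : X \to \mathcal{B}(\mathcal{F},\mathcal{E})$ that multiply $\mathcal{H}_\ell \otimes \mathcal{F}$ into $\mathcal{H}_k \otimes \mathcal{E}$ (pointwise: $(\Phi f)(x) = \Phi(x) f(x)$). Such $\Phi$ is called contractive (respectively partially isometric) if the multiplication operator $M_\Phi : \mathcal{H}_\ell \otimes \mathcal{F} \to \mathcal{H}_k \otimes \mathcal{E}$ is contractive (respectively a partial isometry). $\Phi \cdot (\mathcal{H}_\ell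 \otimes \mathcal{F})$ denotes the range of $M_\Phi$. Products of operator-valued functions such as $\Phi\Gamma$ are pointwise. For closed subspaces $\mathcal{M} \subset \mathcal{H}_k \otimes \mathcal{E}$ and $\mathcal{N} \subset \mathcal{H}_\ell \otimes \mathcal{E}$ (each with the norm inherited from its ambient space), $\mathcal{N}$ is contractively contained in $\mathcal{M}$ if $\mathcal{N} \subset \mathcal{M}$ as sets (of $\mathcal{E}$-valued functions on $X$) and the inclusion map $\mathcal{N} \to \mathcal{M}$ is a contraction. *)

(* Defs.v *)
(* Complex scalars are R[i] with R : realType. *)
From HB Require Import structures.
From mathcomp Require Import all_boot all_order all_algebra.
From mathcomp Require Import complex.
From mathcomp Require Import all_classical all_reals all_analysis.

Set Implicit Arguments.
Unset Strict Implicit.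
Unset Printing Implicit Defensive.
Import Order.TTheory GRing.Theory Num.Theory.
Import numFieldNormedType.Exports.

Local Open Scope classical_set_scope.
Local Open Scope ring_scope.

HB.mixin Record isHilbert (R : realType) (H : Type)
    of CompleteNormedModule R[i] H := {
  (* linear in the first argument, conjugate-linear in the second *)
  hdot : {dot H for (Num.conj : R[i] -> R[i])} ;
  hdot_norm : forall u : H, `|u| ^+ 2 = hdot u u
}.

#[short(type="hilbertType")]
HB.structure Definition Hilbert (R : realType) :=
  {H of isHilbert R H & CompleteNormedModule R[i] H}.

Notation "''[' u , v ]" := (hdot u v)
  (format "''[' u ,  v ]") : ring_scope.

Definition bounded_linear (R : realType) (H K : hilbertType R) (T : H -> K) :=
  linear T /\ exists M : R[i], forall u, `|T u| <= M * `|u|.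

Definition contractive (R : realType) (H K : hilbertType R) (T : H -> K) :=
  linear T /\ forall u, `|T u| <= `|u|.

Definition partial_isometry (R : realType) (H K : hilbertType R)
    (T : H -> K) :=
  bounded_linear T /\
  forall u, (forall v, T v = 0 -> '[u, v] = 0) -> `|T u| = `|u|.

Record bop (R : realType) (H K : hilbertType R) := BOp {
  bop_fun :> H -> K ;
  bopP : bounded_linear bop_fun }.

Definition closed_subspace (R : realType) (H : hilbertType R) (M : set H) :=
  [/\ M 0, forall (a : R[i]) u v, M u -> M v -> M (a *: u + v) & closed M].

Definition psdmx (R : realType) n (A : 'M[R[i]]_n) :=
  forall c : 'I_n -> R[i], 0 <= \sum_i \sum_j (c i)^* * A i j * c j.

Section Kernels.
Context {R : realType} {X : Type}.
Implicit Types k s : X -> X -> R[i].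

Definition is_kernel k := forall n (x : 'I_n -> X),
  injective x -> psdmx (\matrix_(i, j) k (x i) (x j)).

Definition normalized s := exists x0, forall x, s x x0 = 1.

Definition normalized_CNP s :=
  [/\ is_kernel s, normalized s, forall x y, s x y != 0 &
      is_kernel (fun x y => 1 - (s x y)^-1)].

(* The elements of [rkhs_sort] are identified with functions on X by the
   injection [rkhs_ev]; this determines the space up to a unitary commuting
   with the evaluations. *)
Record rkhs k := RKHS {
  rkhs_sort :> hilbertType R ;
  rkhs_ev : {linear rkhs_sort -> (X -> R[i]^o)} ;
  rkhs_ev_inj : injective rkhs_ev ;
  rkhs_ker : X -> rkhs_sort ;
  rkhs_kerE : forall x y, rkhs_ev (rkhs_ker y) x = k x y ;
  rkhs_reproducing : forall f x, '[f, rkhs_ker x] = rkhs_ev f x }.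

End Kernels.

(* The Hilbert space tensor product, up to unitary equivalence. *)
Record htensor (R : realType) (H K : hilbertType R) := HTensor {
  ht_sort :> hilbertType R ;
  ht_pure : {bilinear H -> K -> ht_sort} ;
  ht_dot : forall f g e e',
    '[ht_pure f e, ht_pure g e'] = '[f, g] * '[e, e'] ;
  ht_dense : dense [set u | exists n (f : 'I_n -> H) (e : 'I_n -> K),
    u = \sum_i ht_pure (f i) (e i)] }.

Section Multipliers.
Context {R : realType} {X : Type}.
Implicit Types k l : X -> X -> R[i].

(* H_k (x) E together with its identification with a space of E-valued
   functions on X, in which f (x) e is the function x |-> f(x) e; boundedness
   of the point evaluations makes this identification unique. *)
Record rkhs_tensor k (Hk : rkhs k) (E : hilbertType R) := RKHSTensor {
  rt_tensor :> htensor Hk E ;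
  rt_ev : {linear rt_tensor -> (X -> E)} ;
  rt_ev_inj : injective rt_ev ;
  rt_ev_pure : forall (f : Hk) (e : E) x,
    rt_ev (ht_pure rt_tensor f e) x = rkhs_ev Hk f x *: e ;
  rt_ev_bounded : forall x, bounded_linear (fun f => rt_ev f x) }.

Context {l k : X -> X -> R[i]} {Hl : rkhs l} {Hk : rkhs k}.
Context {F E : hilbertType R}.

Section MultOp.
Variables (HlF : rkhs_tensor Hl F) (HkE : rkhs_tensor Hk E).
Variable Phi : X -> bop F E.

Definition Mult := forall f : HlF, exists g : HkE,
  forall x, rt_ev HkE g x = Phi x (rt_ev HlF f x).

(* M_Phi; the default value 0 is never used when Phi is a multiplier. *)
Definition mult_op (f : HlF) : HkE :=
  xget 0 [set g : HkE | forall x, rt_ev HkE g x = Phi x (rt_ev HlF f x)].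

Definition contractive_mult := Mult /\ contractive mult_op.

Definition partially_isometric_mult := Mult /\ partial_isometry mult_op.

End MultOp.

(* Both sides are compared as subsets of X -> E. *)
Definition contractively_contained (HlE : rkhs_tensor Hl E)
    (HkE : rkhs_tensor Hk E) (N : set HlE) (M : set HkE) :=
  [set rt_ev HlE g | g in N] `<=` [set rt_ev HkE f | f in M] /\
  forall (g : HlE) (f : HkE), N g -> M f ->
    rt_ev HkE f = rt_ev HlE g :> (X -> E) -> `|f| <= `|g|.

End Multipliers.

Arguments mult_op {R X l k Hl Hk F E} HlF HkE Phi f.

(* Main.v *)
Require Import Defs.
From HB Require Import structures.
From mathcomp Require Import all_boot all_order all_algebra.
From mathcomp Require Import complex.
From mathcomp Require Import all_classical all_reals all_analysis.
From mathcomp Require Import spectral ring lra.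

(** The reproducing kernel of M is Phi(x) Phi(y)^* s(x,y) and that of N is
Psi(x) Psi(y)^* s(x,y), because M_Phi and M_Psi are partial isometries with
these ranges.  Contractive containment says that the difference of the two
kernels is positive: writing s_y for the kernel function at y, the assignment

    s_y (x) Phi(y)^* e  |->  s_y (x) Psi(y)^* e      (y in X, e in E)

extends to a linear contraction between subspaces of H_s (x) F and H_s (x) G.
A contractive multiplier Gamma with Psi = Phi Gamma is the same thing as an
extension of this contraction to all vectors s_y (x) f which still has the form
s_y (x) f |-> s_y (x) gamma_y(f): then gamma_y = Gamma(y)^*, and the adjoint of
the contraction is M_Gamma.  So the theorem is an extension problem, and it is
solved one vector at a time, the passage to all vectors being Zorn's lemma
([admissible_total]).

The one-vector extension ([admissible_extend]) is where the Nevanlinna-Pick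
property enters.  Fix a point z and a vector f of F; a vector g of G is wanted
such that s_z (x) f |-> s_z (x) g may be added.  Let (u, v) run through the
graph of the given contraction.  Completing the square in
|v + s_z (x) g|^2 <= |u + s_z (x) f|^2 turns the requirement into

    |v(z) + s(z,z) g|^2  <=  J(u, v),

where J is a quadratic functional of (u, v) whose homogeneous part is
s(z,z) (|u|^2 - |v|^2) + |v(z)|^2.  This part dominates |v(z)|^2, so J is
uniformly convex when measured by v(z); along a minimizing sequence v(z)
converges, and minus the limit, divided by s(z,z), is the required g
([uniformly_convex_min]).  For J to be bounded below one needs

    |u(z)|^2 - |v(z)|^2  <=  s(z,z) (|u|^2 - |v|^2),

that is, the contraction stays contractive after projecting both sides to the
functions that vanish at z ([admissible_eval]).  The difference of the two
sides is the quadratic form of a Schur product of two positive matrices: the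
one that expresses contractivity, and
1 - s(x,z) s(z,y) / (s(x,y) s(z,z)), which is positive because 1 - 1/s is
([cnp_rebase]).

The same minimization principle gives the representation lemma [riesz], from
which come all adjoints and projections that are used. *)

Set Implicit Arguments.
Unset Strict Implicit.
Unset Printing Implicit Defensive.
Import Order.TTheory GRing.Theory Num.Theory.
Import numFieldNormedType.Exports.

Local Open Scope classical_set_scope.
Local Open Scope ring_scope.

(** * Real inner products and squared norms *)

Section RealGeometry.
Local Open Scope complex_scope.
Context {R : realType}.
Implicit Types (H : hilbertType R) (a : R[i]) (t : R).

(** Inequalities are handled in R rather than in the partially ordered field
R[i], through the real part of the inner product. *)
Definition rdot {H} (u v : H) : R := complex.Re '[u, v].
Definition nsq {H} (u : H) : R := rdot u u.

Lemma ReD (a b : R[i]) : complex.Re (a + b) = complex.Re a + complex.Re b.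
Proof. by case: a b => [? ?] [? ?]. Qed.

Lemma ReN (a : R[i]) : complex.Re (- a) = - complex.Re a.
Proof. by case: a. Qed.

Lemma ReZ t (a : R[i]) : complex.Re (t%:C * a) = t * complex.Re a.
Proof. by case: a => x y /=; rewrite mul0r subr0. Qed.

Lemma ReM0 (a b : R[i]) : complex.Im b = 0 ->
  complex.Re (a * b) = complex.Re a * complex.Re b.
Proof. by case: a b => [x y] [z w] /= ->; rewrite mulr0 subr0. Qed.

Lemma Re_conj (a : R[i]) : complex.Re a^* = complex.Re a.
Proof. by case: a. Qed.

Lemma dotDl H (u v w : H) : '[u + v, w] = '[u, w] + '[v, w].
Proof. exact: linearDl. Qed.

Lemma dotDr H (u v w : H) : '[w, u + v] = '[w, u] + '[w, v].
Proof. exact: linearDr. Qed.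

Lemma dotZl H a (u v : H) : '[a *: u, v] = a * '[u, v].
Proof. by rewrite linearZl_LR. Qed.

Lemma dotZr H a (u v : H) : '[u, a *: v] = (a^*)%R * '[u, v].
Proof. by rewrite linearZr_LR. Qed.

Lemma dotC H (u v : H) : '[u, v] = ('[v, u]^*)%R.
Proof. by rewrite (hermC hdot) expr0 mul1r. Qed.

Lemma dotBl H (u v w : H) : '[u - v, w] = '[u, w] - '[v, w].
Proof. exact: linearBl. Qed.

Lemma dotBr H (u v w : H) : '[w, u - v] = '[w, u] - '[w, v].
Proof. exact: linearBr. Qed.

Lemma dot_suml H (I : finType) (f : I -> H) v :
  '[\sum_i f i, v] = \sum_i '[f i, v].
Proof. exact: (linear_sumlz hdot). Qed.

Lemma dot_sumr H (I : finType) (f : I -> H) v :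
  '[v, \sum_i f i] = \sum_i '[v, f i].
Proof. exact: (linear_sumr hdot). Qed.

Lemma rdotC H (u v : H) : rdot u v = rdot v u.
Proof. by rewrite /rdot dotC Re_conj. Qed.

Lemma rdotDl H (u v w : H) : rdot (u + v) w = rdot u w + rdot v w.
Proof. by rewrite /rdot dotDl ReD. Qed.

Lemma rdotDr H (u v w : H) : rdot w (u + v) = rdot w u + rdot w v.
Proof. by rewrite !(rdotC w) rdotDl. Qed.

Lemma rdotNl H (u w : H) : rdot (- u) w = - rdot u w.
Proof. by rewrite -scaleN1r /rdot dotZl mulN1r ReN. Qed.

Lemma rdotNr H (u w : H) : rdot w (- u) = - rdot w u.
Proof. by rewrite !(rdotC w) rdotNl. Qed.

Lemma rdotZl H t (u w : H) : rdot (t%:C *: u) w = t * rdot u w.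
Proof. by rewrite /rdot dotZl ReZ. Qed.

Lemma rdotZr H t (u w : H) : rdot w (t%:C *: u) = t * rdot w u.
Proof. by rewrite !(rdotC w) rdotZl. Qed.

Definition rdotE := (@rdotDl, @rdotDr, @rdotNl, @rdotNr, @rdotZl, @rdotZr).

Lemma dot_nsq H (u : H) : '[u, u] = (nsq u)%:C.
Proof.
by rewrite /nsq /rdot RRe_real // ger0_real // -hdot_norm exprn_ge0.
Qed.

Lemma norm_nsq H (u : H) : `|u| ^+ 2 = (nsq u)%:C.
Proof. by rewrite hdot_norm dot_nsq. Qed.

Lemma nsq_ge0 H (u : H) : 0 <= nsq u.
Proof. by rewrite -ler0c -norm_nsq exprn_ge0. Qed.

Lemma nsq_eq0 H (u : H) : nsq u = 0 -> u = 0.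
Proof.
move=> u0; apply/eqP; rewrite -normr_eq0 -sqrf_eq0.
by rewrite norm_nsq u0.
Qed.

Lemma nsq0 H : nsq (0 : H) = 0.
Proof. by rewrite /nsq -[X in rdot X _](subrr 0) rdotDl rdotNl subrr. Qed.

Lemma nsqD H (u v : H) : nsq (u + v) = nsq u + 2 * rdot u v + nsq v.
Proof. by rewrite /nsq !rdotE (rdotC v u); ring. Qed.

Lemma nsqN H (u : H) : nsq (- u) = nsq u.
Proof. by rewrite /nsq !rdotE opprK. Qed.

Lemma nsqB H (u v : H) : nsq (u - v) = nsq u - 2 * rdot u v + nsq v.
Proof. by rewrite nsqD nsqN rdotNr; ring. Qed.

Lemma nsqZr H t (u : H) : nsq (t%:C *: u) = t ^+ 2 * nsq u.
Proof. by rewrite /nsq !rdotE; ring. Qed.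

Lemma nsqZ H a (u : H) : nsq (a *: u) = complex.Re (`|a| ^+ 2) * nsq u.
Proof.
rewrite {1}/nsq /rdot dotZl dotZr dot_nsq mulrA -normCK mulrC ReZ.
by rewrite mulrC.
Qed.

Lemma ler_norm_nsq H1 H2 (u : H1) (v : H2) :
  (`|u| <= `|v|) = (nsq u <= nsq v).
Proof.
rewrite -lecR -!norm_nsq ler_pXn2r // ?nnegrE //; exact: normr_ge0.
Qed.

Lemma rdot_young H (u v : H) t : 0 < t ->
  2 * rdot u v <= t * nsq u + t^-1 * nsq v.
Proof.
move=> t0; have := nsq_ge0 (t%:C *: u - v).
rewrite nsqB nsqZr rdotZl => h.
rewrite -(ler_pM2l t0) mulrDr mulVKf ?gt_eqF //.
by nra.
Qed.

(** The identity behind uniform convexity of the squared norm. *)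
Lemma nsq_comb H t (u v : H) :
  nsq (t%:C *: (v - u) + u) =
  (1 - t) * nsq u + t * nsq v - t * (1 - t) * nsq (u - v).
Proof. rewrite /nsq !rdotE (rdotC v u); ring. Qed.

Lemma dot_ext H (a b : H) :
  (forall f, '[a, f] = '[b, f]) -> a = b.
Proof.
move=> ab; apply/eqP; rewrite -subr_eq0; apply/eqP/nsq_eq0.
by rewrite /nsq /rdot dotBl ab subrr.
Qed.

(** The order of the two vectors makes the Gram matrix positive in the
convention of [psdmx], where the conjugated coefficient belongs to the row. *)
Lemma gram_sum H (I : finType) (w : I -> H)
    (c : I -> R[i]) :
  \sum_i \sum_j (c i)^*%R * '[w j, w i] * c j =
  (nsq (\sum_i c i *: w i))%:C.
Proof.
rewrite -dot_nsq dot_sumr; apply: eq_bigr => i _.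
by rewrite dot_suml; apply: eq_bigr => j _; rewrite dotZl dotZr; ring.
Qed.

Lemma bounded_nsq H1 H2 (T : H1 -> H2) : bounded_linear T ->
  exists2 m : R, 0 <= m & forall u, nsq (T u) <= m * nsq u.
Proof.
move=> [_ [M TM]]; exists (complex.Re M ^+ 2); first exact: sqr_ge0.
move=> u; have := TM u; rewrite lecE => /andP[_].
have im0 H (w : H) : complex.Im `|w| = 0 by apply: ger0_Im.
have sq H (w : H) : nsq w = complex.Re `|w| ^+ 2.
  by rewrite !expr2 -ReM0 // -expr2 norm_nsq.
have ge0 H (w : H) : 0 <= complex.Re `|w|.
  by have := normr_ge0 w; rewrite lecE => /andP[].
by rewrite ReM0 // !sq -exprMn => h; rewrite lerXn2r // nnegrE // (le_trans _ h).
Qed.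

End RealGeometry.

(** * Minimization of uniformly convex functionals *)

Section Minimization.
Local Open Scope complex_scope.
Context {R : realType}.
Implicit Types (H : hilbertType R).

Lemma nsq_lt_ball H (u v : H) (e : R) : 0 < e ->
  ball u e%:C v <-> nsq (u - v) < e ^+ 2.
Proof.
move=> e0; rewrite -ball_normE /ball_ /=.
by rewrite -(ltr_pXn2r (ltn0Sn 1)) ?nnegrE ?ler0c ?(ltW e0) //
  norm_nsq -rmorphXn /= ltcR.
Qed.

Lemma nsq_complete H (u : nat -> H) (e : nat -> R) :
    (forall c, 0 < c -> exists n0, forall n, (n0 <= n)%N -> e n < c) ->
    (forall m n, nsq (u m - u n) <= e m + e n) ->
  exists p, forall c, 0 < c ->
    exists n0, forall n, (n0 <= n)%N -> nsq (p - u n) < c.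
Proof.
move=> e0 ue.
have sqrtc c : 0 < c -> exists2 d : R, 0 < d & d ^+ 2 = c.
  by move=> c0; exists (Num.sqrt c); rewrite ?sqrtr_gt0 // sqr_sqrtr // ltW.
have ccvg : cvg (u @ \oo).
  apply/cauchy_cvgP/cauchyP => eps.
  rewrite ltcE /= => /andP[/eqP im0 re0].
  have [n0 hn] := e0 (complex.Re eps ^+ 2 / 2) ltac:(by rewrite divr_gt0 // exprn_gt0).
  exists (u n0), n0 => // n /= n0n.
  have -> : eps = (complex.Re eps)%:C by rewrite [LHS]complexE im0 mulr0 addr0.
  apply/nsq_lt_ball => //; apply: le_lt_trans (ue _ _) _.
  by have := hn _ n0n; have := hn _ (leqnn n0); lra.
exists (lim (u @ \oo)) => c /sqrtc[d d0 <-].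
have /(_ _ (nbhsx_ballx _ d%:C _))[] := ccvg.
  by rewrite ltcR.
by move=> n0 _ hn; exists n0 => n /hn /nsq_lt_ball; apply.
Qed.

(** The uniform convexity of J is measured through the map T: minimizing
sequences may diverge in V, but their images under T are Cauchy.  The last
conclusion says that d is the infimum of J on V; the second one is the
Pythagorean inequality at the generalized minimizer. *)
Lemma uniformly_convex_min H (W : Type) (V : set W) (J : W -> R) (T : W -> H)
    (b : R) :
    V !=set0 -> (forall x, V x -> b <= J x) ->
    (forall x y t, V x -> V y -> 0 < t < 1 -> exists2 z, V z &
       J z + t * (1 - t) * nsq (T x - T y) <= (1 - t) * J x + t * J y) ->
  exists d p, [/\ b <= d, forall x, V x -> d + nsq (T x - p) <= J x &
    forall e, 0 < e -> exists2 x, V x & J x < d + e].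
Proof.
move=> [x0 Vx0] Jb Jcvx.
pose d := inf (J @` V).
have hinf : has_inf (J @` V).
  by split; [exists (J x0), x0 | exists b => _ [x Vx <-]; exact: Jb].
have dJ x : V x -> d <= J x by move=> Vx; apply: ge_inf; [case: hinf | exists x].
have bd : b <= d by apply: lb_le_inf; [case: hinf | move=> _ [x Vx <-]; exact: Jb].
have dlim e : 0 < e -> exists2 x, V x & J x < d + e.
  by move=> e0; have [_ [x Vx <-]] := inf_adherent e0 hinf; exists x.
have gap x y t : V x -> V y -> 0 < t < 1 ->
    t * (1 - t) * nsq (T x - T y) <= (1 - t) * (J x - d) + t * (J y - d).
  by move=> Vx Vy /(Jcvx _ _ _ Vx Vy)[z /dJ]; lra.
pose en (n : nat) : R := n.+1%:R^-1.
have en0 n : 0 < en n by rewrite invr_gt0 ltr0Sn.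
have [xn xnP] : {xn : nat -> W & forall n, V (xn n) /\ J (xn n) < d + en n}.
  apply: (@choice _ _ (fun n x => V x /\ J x < d + en n)) => n.
  by have [x ? ?] := dlim _ (en0 n); exists x.
have en_lim c : 0 < c -> exists n0, forall n, (n0 <= n)%N -> en n < c.
  move=> c0; exists (Num.truncn c^-1) => n hn.
  rewrite /en -[c]invrK ltf_pV2 ?posrE ?invr_gt0 ?ltr0Sn //.
  have := truncnS_gt c^-1; move/lt_le_trans; apply.
  by rewrite ler_nat.
have [|m n|p pP] := @nsq_complete _ (T \o xn) (fun n => 2 * en n).
- move=> c c0; have [|n0 hn] := en_lim (c / 2); first by rewrite divr_gt0.
  by exists n0 => n /hn; rewrite ltr_pdivlMr // mulrC.
- have [Vm Jm] := xnP m; have [Vn Jn] := xnP n.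
  have /(gap _ _ _ Vm Vn) : 0 < (2^-1 : R) < 1 by lra.
  move: (nsq _) => /= q; lra.
exists d, p; split => // x Vx.
(* Comparing x with the n-th term of the minimizing sequence by uniform
   convexity with parameter t loses a factor t, and passing from that term to
   its limit p loses another one; both losses vanish as t tends to 1. *)
suff bnd t : 0 < t < 1 -> t ^+ 2 * nsq (T x - p) <= J x - d.
  rewrite addrC -lerBrDr leNgt; apply/negP => lt.
  have := dJ _ Vx; have N0 := nsq_ge0 (T x - p); set q := nsq _ in lt bnd N0.
  set A := J x - d in lt bnd => dJx.
  have A0 : 0 <= A by rewrite subr_ge0.
  have q0 : 0 < q by lra.
  (* With r = A / q < 1, the midpoint of r and 1 has a square exceeding r. *)
  pose t := (1 + A / q) / 2.
  have r1 : 0 <= A / q < 1 by rewrite divr_ge0 //= ltr_pdivrMr // mul1r.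
  have := bnd t; have : A = (A / q) * q by rewrite divfK ?gt_eqF.
  rewrite /t; set r := A / q in r1 * => Arq h.
  have := h ltac:(lra); rewrite Arq ler_pM2r //; nra.
move=> /andP[t0 t1]; apply/ler_addgt0Pr => c c0.
pose c1 := c / 2; have c10 : 0 < c1 by rewrite divr_gt0.
have [n1 h1] := pP (c1 * (1 - t)) ltac:(rewrite mulr_gt0 //; lra).
have [n2 h2] := en_lim (c1 * (1 - t)) ltac:(rewrite mulr_gt0 //; lra).
pose n := maxn n1 n2.
have {}h1 := h1 n (leq_maxl _ _); have {}h2 := h2 n (leq_maxr _ _).
have [Vn Jn] := xnP n.
have g := gap _ _ t Vx Vn ltac:(lra).
(* The weight (1 - t) / t makes the coefficient of the first square 1 / t. *)
have y := rdot_young (T x - T (xn n)) (T (xn n) - p) (t := (1 - t) / t)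
  ltac:(rewrite divr_gt0 //; lra).
have -> : T x - p = (T x - T (xn n)) + (T (xn n) - p) by rewrite subrKA.
have e1 : nsq (T (xn n) - p) = nsq (p - (T \o xn) n) by rewrite -nsqN opprB.
rewrite nsqD e1; rewrite e1 invf_div in y.
have q0 := nsq_ge0 (p - (T \o xn) n).
move: (nsq (T x - _)) (rdot _ _) (nsq _) q0 g y h1 => a r q q0 g y h1.
have y' : t * (2 * r) * (1 - t) <= (1 - t) ^+ 2 * a + t ^+ 2 * q.
  have := ler_wpM2l (ltW (mulr_gt0 t0 (_ : 0 < 1 - t))) y.
  have -> : t * (1 - t) * ((1 - t) / t * a + t / (1 - t) * q) =
      (1 - t) ^+ 2 * a + t ^+ 2 * q.
    by field; lra.
  by move=> h; have := h ltac:(lra); lra.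
have [y2 y3] : t * (t * (2 * r) * (1 - t)) <=
    t * ((1 - t) ^+ 2 * a + t ^+ 2 * q)
    /\ t * (J (xn n) - d) <= 1 * (c1 * (1 - t)).
  split; first by rewrite ler_pM2l.
  by rewrite ler_pM //; [lra|have := dJ _ Vn; lra|lra|lra].
have y4 : t ^+ 2 * q <= 1 * (c1 * (1 - t)).
  by rewrite ler_pM ?sqr_ge0 // ?(ltW h1) //; nra.
rewrite -(ler_pM2r (_ : 0 < 1 - t)); last by lra.
have cE : c = c1 + c1 by rewrite /c1; lra.
rewrite cE; lra.
Qed.

End Minimization.

(** * Representation of functionals, adjoints, projections *)

Section Riesz.
Local Open Scope complex_scope.
Context {R : realType}.
Implicit Types (H K : hilbertType R).

(** D is the graph of a bounded functional on a linear subspace of H; a relation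
rather than a function, because the adjoint of the contraction spanned by an
admissible relation below is given by its graph.  The bound
2 Re x <= |u|^2 + b says that |u|^2 - 2 Re x, whose minimizer represents the
functional, is bounded below.  The last conclusion puts the representing
vector in the closure of the domain, which is what makes the lemma yield
orthogonal projections. *)
Lemma riesz H (D : H -> R[i] -> Prop) (b : R) :
    D 0 0 ->
    (forall c u v x y, D u x -> D v y -> D (c *: u + v) (c * x + y)) ->
    (forall u x, D u x -> 2 * complex.Re x <= nsq u + b) ->
  exists z : H, [/\ forall u x, D u x -> x = '[u, z], nsq z <= b &
    forall e, 0 < e -> exists2 u, (exists x, D u x) & nsq (u - z) < e].
Proof.
move=> D0 Dlin Db.
pose J (w : H * R[i]) := nsq w.1 - 2 * complex.Re w.2.
have [||[u x] [v y] t Vx Vy t01|d [z [bd Jd Jlim]]] :=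
    @uniformly_convex_min R H _ [set w | D w.1 w.2] J fst (- b).
- by exists (0, 0).
- by move=> [u x] /= /Db; rewrite /J /=; lra.
- exists (t%:C *: (v - u) + u, t%:C * (y - x) + x).
    rewrite /=; apply: (Dlin) => //; have := Dlin (-1) _ _ _ _ Vx Vy.
    by rewrite scaleN1r mulN1r addrC [- x + y]addrC.
  rewrite /J /= nsq_comb ReD ReZ ReD ReN; lra.
have d0 : d + nsq z <= 0.
  by have := Jd (0, 0) D0; rewrite /J /= sub0r nsqN nsq0; lra.
exists z; split; last 1 first.
- move=> e /Jlim[[u x] Vx Jx]; exists u; first by exists x.
  by have := Jd _ Vx; rewrite /= in Jx *; lra.
- move=> u x Dux.
  have re0 v y : D v y -> complex.Re y = rdot v z.
    move=> Dvy.
    (* The linear function t |-> 2 t Re (y - <v, z>) is bounded above, hence 0. *)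
    have bnd t : 2 * t * (complex.Re y - rdot v z) <= - (d + nsq z).
      have := Dlin t%:C _ _ _ _ Dvy D0; rewrite !addr0 => /(Jd (_, _)).
      rewrite /J /= nsqB nsqZr ReZ rdotZl; lra.
    apply/eqP; rewrite -subr_eq0; apply/negPn/negP => a0.
    have := bnd ((1 - (d + nsq z)) / (complex.Re y - rdot v z)).
    rewrite -mulrA divfK //; lra.
  have im0 : complex.Re ('i * x) = rdot ('i *: u) z.
    apply: re0; have := Dlin 'i _ _ _ _ Dux D0; by rewrite !addr0.
  move: (re0 _ _ Dux) im0; rewrite /rdot dotZl.
  case: ('[u, z]) x {Dux} => [p q] [p' q'] /= ->.
  by rewrite !mul0r !mul1r !sub0r => /oppr_inj->.
- by lra.
Qed.

(** The vector f is T^* e. *)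
Lemma adjoint_vector H K (T : H -> K) (e : K) : bounded_linear T ->
  exists f : H, forall u, '[T u, e] = '[u, f].
Proof.
move=> Tb; have [m m0 Tm] := bounded_nsq Tb; have [Tl _] := Tb.
have T0 : T 0 = 0.
  by have := Tl (-1) 0 0; rewrite scaler0 add0r scaleN1r addNr.
have m1 : 0 < m + 1 by lra.
have [||u _ ->|f [fP _ _]] :=
    @riesz H (fun u x => x = '[T u, e]) ((m + 1) * nsq e).
- by rewrite T0 (linear0l hdot).
- by move=> c u v _ _ -> ->; rewrite Tl dotDl dotZl.
- have := rdot_young (T u) e (t := (m + 1)^-1); rewrite invr_gt0 => /(_ m1).
  rewrite invrK; have : (m + 1)^-1 * nsq (T u) <= nsq u.
    rewrite ler_pdivrMl // (le_trans (Tm u)) // mulrDl lerDl mul1r.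
    exact: nsq_ge0.
  rewrite /rdot; lra.
by exists f => u; apply: fP.
Qed.

(** Subtracting from h its projection to the kernel of T gives a vector on which
T is isometric.  The kernel is closed because T is bounded. *)
Lemma partial_isometry_lift H K (T : H -> K) (h : H) : partial_isometry T ->
  exists2 h', T h' = T h & nsq h' = nsq (T h).
Proof.
move=> [Tb Tiso]; have [m m0 Tm] := bounded_nsq Tb; have [Tl _] := Tb.
have TB u v : T (u - v) = T u - T v.
  by rewrite addrC -scaleN1r Tl scaleN1r addrC.
have T0 : T 0 = 0 by rewrite -(subrr 0) TB subrr.
have [||u _ [_ ->]|z [zP _ zlim]] :=
    @riesz H (fun u x => T u = 0 /\ x = '[u, h]) (nsq h).
- by rewrite (linear0l hdot).
- move=> c u v _ _ [Tu ->] [Tv ->].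
  by rewrite Tl Tu Tv scaler0 addr0 dotDl dotZl.
- by have := nsq_ge0 (u - h); rewrite nsqB /rdot; lra.
have Tz : T z = 0.
  apply: nsq_eq0; apply/eqP; rewrite eq_le nsq_ge0 andbT.
  apply/ler_addgt0Pr => e e0; rewrite add0r.
  have m1 : 0 < m + 1 by lra.
  have [|u [_ [Tu _]] uz] := zlim (e / (m + 1)); first by rewrite divr_gt0.
  have := Tm (u - z); rewrite TB Tu sub0r nsqN => /le_trans; apply.
  move: uz; rewrite ltr_pdivlMr //; have := nsq_ge0 (u - z); nra.
have Th : T (h - z) = T h by rewrite TB Tz subr0.
exists (h - z) => //; rewrite -Th; apply: complexI.
rewrite -!norm_nsq Tiso // => v Tv.
by rewrite dotC dotBr (zP v '[v, h] (conj Tv erefl)) subrr conjC0.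
Qed.

End Riesz.

(** * Positive matrices and kernels *)

Section PositiveForms.
Local Open Scope sesquilinear_scope.
Context {R : realType}.
Local Notation C := R[i].

(** The condition of [psdmx] for arbitrary finite index types, which spares
enumerations when families are concatenated or a point is added. *)
Definition psd (I : finType) (A : I -> I -> C) :=
  forall c : I -> C, 0 <= \sum_i \sum_j (c i)^* * A i j * c j.

(** Repeated indices only regroup the coefficients. *)
Lemma psd_pull (I J : finType) (A : I -> I -> C) (x : J -> I) :
  psd A -> psd (fun i j => A (x i) (x j)).
Proof.
move=> Apsd c; pose d (i : I) := \sum_(j | x j == i) c j.
rewrite (_ : \sum_i _ = \sum_i \sum_j (d i)^* * A i j * d j); first exact: Apsd.
rewrite (partition_big x predT) //=; apply: eq_bigr => i _.
transitivity (\sum_(m | x m == i) \sum_j (c m)^* * A i j * d j).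
  apply: eq_bigr => m /eqP xm; rewrite (partition_big x predT) //=.
  apply: eq_bigr => j _; rewrite mulr_sumr; apply: eq_bigr => n /eqP xn.
  by rewrite xm xn.
by rewrite exchange_big /=; apply: eq_bigr => j _; rewrite -!mulr_suml -rmorph_sum.
Qed.

(** By polarization: the form is real on the vectors e_i, e_j, e_i + e_j and
e_i + i e_j. *)
Lemma psd_herm (I : finType) (A : I -> I -> C) i j :
  psd A -> A j i = (A i j)^*.
Proof.
move=> /(@psd_pull _ bool _ (fun b => if b then i else j)) Ab.
have h a b := Ab (fun t => if t then a else b).
have hre a b : complex.Im (a^* * A i i * a + a^* * A i j * b
    + (b^* * A j i * a + b^* * A j j * b)) = 0.
  by apply: ger0_Im; have := h a b; rewrite !big_bool.
move: (hre 1 0) (hre 0 1) (hre 1 1) (hre 1 'i%C).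
case: (A i i) (A i j) (A j i) (A j j) => [a1 a2] [b1 b2] [c1 c2] [d1 d2] /=.
move=> h1 h2 h3 h4; rewrite /GRing.one /=; congr Complex; lra.
Qed.

(** Schur product theorem.  Diagonalizing B by a unitary matrix writes it as a
sum of positive multiples of rank one matrices, and the Schur product of A with
a rank one matrix is A after rescaling the coefficients. *)
Lemma psd_schur (I : finType) (A B : I -> I -> C) :
  psd A -> psd B -> psd (fun i j => A i j * B i j).
Proof.
move=> Apsd Bpsd.
pose M : 'M[C]_#|I| := \matrix_(i, j) B (enum_val i) (enum_val j).
have Mherm : M \is hermsymmx.
  apply/is_hermitianmxP; rewrite expr0 scale1r; apply/matrixP => i j.
  by rewrite !mxE; apply: psd_herm.
have /hermitian_normalmx/orthomx_spectralP := Mherm.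
set P := spectralmx M; set D := spectral_diag M => ME.
have Pu : P \in unitmx := spectral_unit M.
have Pinv : invmx P = P ^t* by apply/invmx_unitary/spectral_unitarymx.
have Mij i j : M i j = \sum_k D 0 k * ((P k i)^* * P k j).
  rewrite ME mul_mx_diag Pinv mxE; apply: eq_bigr => k _; rewrite !mxE; ring.
have D0 k : 0 <= D 0 k.
  have : diag_mx D = P *m M *m invmx P.
    by rewrite ME !mulmxA mulmxV // mul1mx mulmxK.
  move/matrixP/(_ k k); rewrite mxE eqxx mulr1n Pinv => ->.
  have := @psd_pull I 'I_#|I| B (fun i => enum_val i) Bpsd (fun i => (P k i)^*).
  congr (_ <= _); rewrite exchange_big /= mxE; apply: eq_bigr => j _ /=.
  rewrite !mxE mulr_suml; apply: eq_bigr => i _.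
  by rewrite conjCK !mxE.
move=> c; rewrite (_ : \sum_i _ = \sum_k D 0 k * \sum_i \sum_j
   (c i * P k (enum_rank i))^* * A i j * (c j * P k (enum_rank j))).
  by apply: sumr_ge0 => k _; apply: mulr_ge0 => //; apply: Apsd.
under [RHS]eq_bigr => k _ do rewrite mulr_sumr.
rewrite [RHS]exchange_big /=; apply: eq_bigr => i _.
under [RHS]eq_bigr => k _ do rewrite mulr_sumr.
rewrite [RHS]exchange_big /=; apply: eq_bigr => j _.
have -> : B i j = M (enum_rank i) (enum_rank j) by rewrite mxE !enum_rankK.
rewrite Mij !mulr_sumr mulr_suml; apply: eq_bigr => k _.
by rewrite rmorphM; ring.
Qed.

(** Positivity of a kernel is required at distinct points only; repeated points
are reduced to it by [psd_pull]. *)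
Lemma kernel_psd (X : Type) (k : X -> X -> C) (I : finType) (x : I -> X) :
  is_kernel k -> psd (fun i j => k (x i) (x j)).
Proof.
move=> kk; pose x' : I -> {classic X} := x.
pose u := undup [seq x' i | i <- enum I].
pose y (a : 'I_(size u)) : {classic X} := tnth (in_tuple u) a.
have uP i : x' i \in u by rewrite mem_undup map_f // mem_enum.
have xu i : (index (x' i) u < size u)%N by rewrite index_mem.
have y_inj : injective y by apply/tuple_uniqP; apply: undup_uniq.
have yf i : y (Ordinal (xu i)) = x i.
  by rewrite /y (tnth_nth (x' i)) /= nth_index.
have kpsd : psd (fun a b => k (y a) (y b)).
  move=> c; have := kk _ y y_inj c.
  by under eq_bigr => a _ do under eq_bigr => b _ do rewrite mxE.
have := psd_pull (fun i => Ordinal (xu i)) kpsd.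
by move=> h c; have := h c;
  under eq_bigr => a _ do under eq_bigr => b _ do rewrite !yf.
Qed.

Lemma kernel_herm (X : Type) (k : X -> X -> C) x y :
  is_kernel k -> k y x = (k x y)^*.
Proof.
by move=> /(@kernel_psd _ _ _ (fun b => if b then x else y)) /(psd_herm true false).
Qed.

Lemma kernel_diag_ge0 (X : Type) (k : X -> X -> C) x :
  is_kernel k -> 0 <= k x x.
Proof.
move=> /(@kernel_psd _ _ _ (fun _ : unit => x)) /(_ (fun=> 1)).
by rewrite !big_const card_unit /= !addr0 conjC1 mul1r mulr1.
Qed.

(** This is the Nevanlinna-Pick condition for the kernel s normalized at z.  If
b is a feature map of p = 1 - 1/s, that is p(x,y) = <b_x, b_y>, and
w = sum_i d_i (b_(x_i) - b_z) up to conjugation of the coefficients, then after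
the rescaling d_i = s(z,x_i) c_i the form is
(1 - |b_z|^2) |w|^2 + |<w, b_z>|^2, where 1 - |b_z|^2 = 1 / s(z,z) > 0.  The
proof uses p directly, so |w|^2 becomes the form of p at the points x_i together
with z, the latter with coefficient - sum_i d_i. *)
Lemma cnp_rebase (X : Type) (s : X -> X -> C) (z : X) (I : finType) (x : I -> X) :
  normalized_CNP s ->
  psd (fun i j => 1 - s (x i) z * s z (x j) / (s (x i) (x j) * s z z)).
Proof.
move=> [ks _ s0 kp] c.
pose p x y := 1 - (s x y)^-1.
have sE x' y' : s x' y' = (1 - p x' y')^-1 by rewrite /p subKr invrK.
have p0 x' y' : 1 - p x' y' != 0 by rewrite /p subKr invr_eq0 s0.
pose d i := s z (x i) * c i.
pose x1 (o : 'I_1 + I) := if o is inr i then x i else z.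
pose d1 (o : 'I_1 + I) := if o is inr i then d i else - \sum_i d i.
have szz : 0 <= (s z z)^-1 by rewrite invr_ge0 kernel_diag_ge0.
have P1 := kernel_psd x1 kp d1.
have P2 := mul_conjC_ge0 (\sum_i d i * (p z (x i) - p z z)).
have hp i : p (x i) z = (p z (x i))^* by exact: kernel_herm.
have hpz : p z z = (p z z)^* by exact: kernel_herm.
have hs i : s (x i) z = (s z (x i))^* by exact: kernel_herm.
have := addr_ge0 (mulr_ge0 szz P1) P2; congr (_ <= _).
have -> : \sum_i \sum_j (d1 i)^* * (1 - (s (x1 i) (x1 j))^-1) * d1 j =
    \sum_i \sum_j (d i)^* * d j * (p (x i) (x j) - p (x i) z - p z (x j) + p z z).
  rewrite -[LHS]/(\sum_i \sum_j (d1 i)^* * p (x1 i) (x1 j) * d1 j).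
  rewrite big_sumType /= big_ord1 big_sumType /= big_ord1.
  under [X in _ + X = _]eq_bigr => i _ do rewrite big_sumType /= big_ord1.
  set S := \sum_i d i.
  have SE : S^* = \sum_i (d i)^* by rewrite rmorph_sum.
  have T1 : (- S)^* * p z z * - S = \sum_i \sum_j (d i)^* * p z z * d j.
    by rewrite rmorphN /= SE mulrN !mulNr opprK mulr_suml big_distrlr.
  have T2 : \sum_i (- S)^* * p z (x i) * d i =
      \sum_i \sum_j - ((d i)^* * (p z (x j) * d j)).
    under eq_bigr => i _ do rewrite -mulrA.
    rewrite -mulr_sumr rmorphN /= SE mulNr big_distrlr /= -sumrN.
    by apply: eq_bigr => i _; rewrite sumrN.
  have T3 i : (d i)^* * p (x i) z * - S = \sum_j - ((d i)^* * p (x i) z * d j).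
    by rewrite mulrN mulr_sumr sumrN.
  rewrite T1 T2; under [X in _ + X = _]eq_bigr => i _ do rewrite T3 -big_split /=.
  rewrite -!big_split /=; apply: eq_bigr => i _.
  by rewrite -!big_split /=; apply: eq_bigr => j _; ring.
rewrite rmorph_sum [X in _ + X]mulrC big_distrlr mulr_sumr -big_split.
apply: eq_bigr => i _; rewrite mulr_sumr -big_split; apply: eq_bigr => j _ /=.
have -> : (c i)^* = (d i)^* / s (x i) z.
  by rewrite /d rmorphM hs mulrC mulKf // conjC_eq0.
have -> : c j = d j / s z (x j) by rewrite /d mulrC mulKf.
have -> : (d i * (p z (x i) - p z z))^* = (d i)^* * (p (x i) z - p z z).
  by rewrite hp {2}hpz -rmorphB -rmorphM.
rewrite !sE; field.
by rewrite !p0.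
Qed.

End PositiveForms.

(** * Kernel vectors in a vector-valued reproducing kernel space *)

Section Tensor.
Local Open Scope complex_scope.
Context {R : realType} {X : Type} {s : X -> X -> R[i]} {Hs : rkhs s}.
Context {F : hilbertType R} (HsF : rkhs_tensor Hs F).

Definition kvec (y : X) (f : F) : HsF := ht_pure HsF (rkhs_ker Hs y) f.

Lemma ev_kvec x y f : rt_ev HsF (kvec y f) x = s x y *: f.
Proof. by rewrite rt_ev_pure rkhs_kerE. Qed.

Lemma kvec_linear y a f g : kvec y (a *: f + g) = a *: kvec y f + kvec y g.
Proof. by rewrite /kvec linearPr. Qed.

Lemma ev_sum (I : finType) (h : I -> HsF) x :
  rt_ev HsF (\sum_i h i) x = \sum_i rt_ev HsF (h i) x.
Proof. by rewrite linear_sum fct_sumE. Qed.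

Lemma evP x a (g h : HsF) :
  rt_ev HsF (a *: g + h) x = a *: rt_ev HsF g x + rt_ev HsF h x.
Proof. by rewrite linearP. Qed.

Lemma evB (g h : HsF) x :
  rt_ev HsF (g - h) x = rt_ev HsF g x - rt_ev HsF h x.
Proof. by rewrite linearB. Qed.

Lemma ev_comb (I : finType) (c : I -> R[i]) (h : I -> HsF) x :
  rt_ev HsF (\sum_i c i *: h i) x = \sum_i c i *: rt_ev HsF (h i) x.
Proof. by rewrite ev_sum; apply: eq_bigr => i _; rewrite linearZ. Qed.

(** Reproducing property for vector-valued functions.  It holds on elementary
tensors by construction; since evaluation at y is bounded, h |-> <h(y), f> is
represented by some vector z, and z - s_y (x) f is orthogonal to a dense set. *)
Lemma dot_kvec (h : HsF) y f : '[h, kvec y f] = '[rt_ev HsF h y, f].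
Proof.
have [z zP] := adjoint_vector f (rt_ev_bounded HsF y).
rewrite zP; suff -> : kvec y f = z by [].
apply/eqP; rewrite -subr_eq0; apply/eqP/nsq_eq0/eqP; rewrite eq_le nsq_ge0 andbT.
apply/ler_addgt0Pr => e e0; rewrite add0r.
set w := kvec y f - z.
pose r := Num.sqrt e; have r0 : 0 < r by rewrite sqrtr_gt0.
have [||u [wu [n [g [f' uE]]]]] := @ht_dense _ _ _ HsF (ball w r%:C)°.
- by exists w; apply: nbhsx_ballx; rewrite ltcR.
- exact: open_interior.
have /interior_subset/(nsq_lt_ball _ _ r0) := wu; rewrite sqr_sqrtr ?(ltW e0) //.
suff uw : '[u, w] = 0.
  by rewrite (nsqB w u) rdotC /rdot uw /= => we; have := nsq_ge0 u; lra.
rewrite uE dot_suml big1 // => i _.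
by rewrite dotBr -zP rt_ev_pure dotZl ht_dot rkhs_reproducing subrr.
Qed.

Lemma nsq_kvec y f : is_kernel s -> nsq (kvec y f) = complex.Re (s y y) * nsq f.
Proof.
move=> ks; rewrite {1}/nsq /rdot dot_kvec ev_kvec dotZl ReM0 //.
by rewrite dot_nsq.
Qed.

End Tensor.

Section Kernel.
Local Open Scope complex_scope.
Context {R : realType} {X : Type} (s : X -> X -> R[i]).
Context (hs : normalized_CNP s).

Lemma cnp_diagE x : s x x = (complex.Re (s x x))%:C.
Proof. by case: hs => ks _ _ _; rewrite RRe_real // ger0_real // kernel_diag_ge0. Qed.

Lemma cnp_diag_gt0 x : 0 < complex.Re (s x x).
Proof.
case: (hs) => ks _ s0 _; rewrite -ltcR -cnp_diagE.
by rewrite lt_neqAle kernel_diag_ge0 // andbT eq_sym s0.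
Qed.

End Kernel.

(** * Admissible relations and extension by one vector *)

Section Extension.
Local Open Scope complex_scope.
Context {R : realType} {X : Type} {s : X -> X -> R[i]} {Hs : rkhs s}.
Context {F G : hilbertType R}.
Context (HsF : rkhs_tensor Hs F) (HsG : rkhs_tensor Hs G).
Implicit Types (S : set (X * F * G)) (u : HsF) (v : HsG).

(** A triple (y, f, g) of S stands for the assignment
s_y (x) f |-> s_y (x) g; kspan S is the linear relation spanned by these
assignments. *)
Definition kspan S u v := exists (I : finType) (c : I -> R[i])
  (a : I -> X * F * G), [/\ forall i, S (a i),
    u = \sum_i c i *: kvec HsF (a i).1.1 (a i).1.2 &
    v = \sum_i c i *: kvec HsG (a i).1.1 (a i).2].

(** Such a relation is automatically the graph of a linear map. *)
Definition admissible S := forall u v, kspan S u v -> nsq v <= nsq u.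

Lemma kspan0 S : kspan S 0 0.
Proof.
exists void, (fun=> 0), (@of_void _).
by split => [[]||]; rewrite big1 // => - [].
Qed.

Lemma kspan_elem S y f g : S (y, f, g) -> kspan S (kvec HsF y f) (kvec HsG y g).
Proof.
move=> Sa; exists unit, (fun=> 1), (fun=> (y, f, g)).
by split => //=; rewrite big_const card_unit /= addr0 scale1r.
Qed.

Lemma kspan_lin S c u v u' v' : kspan S u v -> kspan S u' v' ->
  kspan S (c *: u + u') (c *: v + v').
Proof.
move=> [I [d [a [Sa -> ->]]]] [J [e [b [Sb -> ->]]]].
exists (I + J)%type, (fun o => match o with inl i => c * d i | inr j => e j end),
  (fun o => match o with inl i => a i | inr j => b j end).
split; first by case.
- rewrite big_sumType /= scaler_sumr; congr (_ + _).
  by apply: eq_bigr => i _; rewrite scalerA.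
- rewrite big_sumType /= scaler_sumr; congr (_ + _).
  by apply: eq_bigr => i _; rewrite scalerA.
Qed.

(** The form of this matrix at c is |u|^2 - |v|^2 for the element (u, v) of the
span with coefficients c. *)
Lemma admissible_psd S (I : finType) (a : I -> X * F * G) :
  admissible S -> (forall i, S (a i)) ->
  psd (fun i j =>
    '[kvec HsF (a j).1.1 (a j).1.2, kvec HsF (a i).1.1 (a i).1.2] -
    '[kvec HsG (a j).1.1 (a j).2, kvec HsG (a i).1.1 (a i).2]).
Proof.
move=> Sadm Sa c.
under eq_bigr => i _ do under eq_bigr => j _ do rewrite mulrBr mulrBl.
under eq_bigr => i _ do rewrite big_split sumrN.
rewrite big_split sumrN /= !gram_sum subr_ge0 lecR.
by apply: Sadm; exists I, c, a.
Qed.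

(** The squared norm of the projection of u to the functions vanishing at z is
|u|^2 - |u(z)|^2 / s(z,z).  Passing to these projections multiplies the (i, j)
entry of the matrix in [admissible_psd] by
1 - s(x_i,z) s(z,x_j) / (s(x_i,x_j) s(z,z)), so the Schur product theorem and
[cnp_rebase] apply. *)
Lemma admissible_eval S z u v : normalized_CNP s -> admissible S ->
    kspan S u v ->
  nsq (rt_ev HsF u z) - nsq (rt_ev HsG v z) <=
  complex.Re (s z z) * (nsq u - nsq v).
Proof.
move=> hs Sadm [I [c [a [Sa uE vE]]]].
have [ks _ s0 _] := hs; have szz := cnp_diag_gt0 hs z.
pose x i := (a i).1.1.
have := psd_schur (admissible_psd Sadm Sa) (cnp_rebase z x hs) c.
rewrite (_ : \sum_i _ = (nsq u)%:C - (nsq v)%:C - ((s z z)^-1 *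
    (nsq (rt_ev HsF u z))%:C - (s z z)^-1 * (nsq (rt_ev HsG v z))%:C)); last first.
  rewrite uE vE !ev_comb -!gram_sum !mulr_sumr -!sumrB; apply: eq_bigr => i _.
  rewrite !mulr_sumr -!sumrB; apply: eq_bigr => j _.
  rewrite !dot_kvec !ev_kvec !dotZl !dotZr -/(x i) -/(x j) (kernel_herm z (x i) ks).
  by field; rewrite !s0.
rewrite cnp_diagE // -mulrBr -!rmorphB -fmorphV -rmorphM -rmorphB ler0c => h.
have := ler_wpM2l (ltW szz) h.
by rewrite mulr0 mulrBr mulVKf ?gt_eqF // subr_ge0.
Qed.

(** Minimizing the functional J of the proof gives a vector p such that
|v(z) - p|^2 <= J(u, v) for all (u, v) in the span;
the term |v(z)|^2 cancels when the square is expanded, and g = - p / s(z,z)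
satisfies the claim. *)
Lemma admissible_extend S z f : normalized_CNP s -> admissible S ->
  exists g, forall u v, kspan S u v ->
    nsq (v + kvec HsG z g) <= nsq (u + kvec HsF z f).
Proof.
move=> hs Sadm; have [ks _ s0 _] := hs; have szz := cnp_diag_gt0 hs z.
set t0 := complex.Re (s z z) in szz.
have nsq_u u : nsq (u + kvec HsF z f) =
    nsq u + 2 * rdot (rt_ev HsF u z) f + t0 * nsq f.
  by rewrite nsqD nsq_kvec // {1}/rdot dot_kvec.
have nsq_v v g : nsq (v + kvec HsG z g) =
    nsq v + 2 * rdot (rt_ev HsG v z) g + t0 * nsq g.
  by rewrite nsqD nsq_kvec // {1}/rdot dot_kvec.
pose J (w : HsF * HsG) := t0 * (nsq (w.1 + kvec HsF z f) - nsq w.2) +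
  nsq (rt_ev HsG w.2 z).
have JE (w : HsF * HsG) : J w = t0 * (nsq w.1 - nsq w.2) + nsq (rt_ev HsG w.2 z)
    + 2 * t0 * rdot (rt_ev HsF w.1 z) f + t0 ^+ 2 * nsq f.
  by rewrite /J nsq_u; ring.
have [||[u v] [u' v'] t Vx Vy t01|d [p [d0 Jd _]]] :=
  @uniformly_convex_min R G _ [set w | kspan S w.1 w.2] J
    (fun w => rt_ev HsG w.2 z) 0.
- by exists (0, 0); apply: kspan0.
- move=> [u v] /= /(admissible_eval z hs Sadm); rewrite -/t0 => h.
  have := nsq_ge0 (rt_ev HsF u z + t0%:C *: f).
  rewrite nsqD nsqZr rdotZr JE /=; lra.
- exists (t%:C *: (u' - u) + u, t%:C *: (v' - v) + v).
    rewrite /=; apply: (kspan_lin) => //; have := kspan_lin (-1) Vx Vy.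
    by rewrite !scaleN1r ![- _ + _]addrC.
  have h : 0 <= t * (1 - t) * (t0 * (nsq (u - u') - nsq (v - v'))).
    apply: mulr_ge0; first by apply: mulr_ge0; lra.
    apply: mulr_ge0; first exact: ltW.
    rewrite subr_ge0; apply: Sadm.
    by have := kspan_lin (-1) Vy Vx; rewrite !scaleN1r ![- _ + _]addrC.
  rewrite !JE /= !evP !evB !nsq_comb !rdotE; lra.
exists ((- t0^-1)%:C *: p) => u v /(Jd (u, v)).
rewrite /J /= nsqB nsq_v rdotZr nsqZr; set q := nsq (_ + kvec HsF z f) => h.
rewrite -(ler_pM2l szz) !mulrDr.
have -> : t0 * (2 * (- t0^-1 * rdot (rt_ev HsG v z) p)) = - 2 * rdot (rt_ev HsG v z) p.
  by field; rewrite gt_eqF.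
have -> : t0 * (t0 * ((- t0^-1) ^+ 2 * nsq p)) = nsq p by field; rewrite gt_eqF.
lra.
Qed.

End Extension.

(** * Maximal admissible relations and their multipliers *)

Section Maximal.
Local Open Scope complex_scope.
Context {R : realType} {X : Type} {s : X -> X -> R[i]} {Hs : rkhs s}.
Context {F G : hilbertType R}.
Context (HsF : rkhs_tensor Hs F) (HsG : rkhs_tensor Hs G).
Implicit Types S A B : set (X * F * G).
Local Notation admissible := (admissible HsF HsG).

(** By homogeneity it suffices to test the new vector with coefficient 1. *)
Lemma admissible_setU1 S z f g : admissible S ->
    (forall u v, kspan S u v -> nsq (v + kvec HsG z g) <= nsq (u + kvec HsF z f)) ->
  admissible (S `|` [set (z, f, g)]).
Proof.
move=> Sadm ext u v [I [d [a [Sa uE vE]]]].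
pose Q u v := exists c u' v', [/\ kspan S u' v', u = u' + c *: kvec HsF z f &
  v = v' + c *: kvec HsG z g].
have [c [u' [v' [k -> ->]]]] : Q u v.
  rewrite uE vE; apply: (big_ind2 Q).
  - by exists 0, 0, 0; split; rewrite ?scale0r ?addr0 //; apply: kspan0.
  - move=> _ _ _ _ [c [u1 [v1 [k1 -> ->]]]] [c' [u2 [v2 [k2 -> ->]]]].
    exists (c + c'), (u1 + u2), (v1 + v2); rewrite !scalerDl (addrACA u1) (addrACA v1).
    by split=> //; have := kspan_lin 1 k1 k2; rewrite !scale1r.
  - move=> i _; have [Si|-> /=] := Sa i.
      exists 0, (d i *: kvec HsF (a i).1.1 (a i).1.2), (d i *: kvec HsG (a i).1.1 (a i).2).
      rewrite !scale0r !addr0; split => //.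
      rewrite -[X in kspan _ X]addr0 -[X in kspan _ _ X]addr0.
      apply: kspan_lin; last exact: kspan0.
      by apply: kspan_elem; case: (a i) Si => [[]].
    by exists (d i), 0, 0; rewrite !add0r; split => //; apply: kspan0.
have [->|c0] := eqVneq c 0; first by rewrite !scale0r !addr0; apply: Sadm.
have := kspan_lin c^-1 k (kspan0 HsF HsG S); rewrite !addr0 => /ext.
have -> : v' + c *: kvec HsG z g = c *: (c^-1 *: v' + kvec HsG z g).
  by rewrite scalerDr scalerA divff // scale1r.
have -> : u' + c *: kvec HsF z f = c *: (c^-1 *: u' + kvec HsF z f).
  by rewrite scalerDr scalerA divff // scale1r.
rewrite !(nsqZ c) => h; apply: ler_wpM2l => //.
by rewrite -ler0c RRe_real ?exprn_ge0 // ger0_real // exprn_ge0.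
Qed.

(** An element of the span involves finitely many triples, which lie in S
together with a single member of the chain. *)
Lemma admissible_chain S (C : set (set (X * F * G))) : admissible S ->
    (forall A, C A -> admissible (S `|` A)) -> total_on C subset ->
  admissible (S `|` \bigcup_(A in C) A).
Proof.
move=> Sadm Cadm Ctot u v [I [d [a [Sa uE vE]]]].
have [A [CA Aa]] : exists A, (A = set0 \/ C A) /\
    forall i, i \in enum I -> (S `|` A) (a i).
  elim: (enum I) => [|i r [A [CA Aa]]]; first by exists set0; split; [left|].
  have [Si|[B CB Bi]] := Sa i.
    by exists A; split => // j; rewrite inE => /orP[/eqP->|/Aa //]; left.
  have [B' [CB' AB' BB']] : exists B', [/\ C B', A `<=` B' & B `<=` B'].
    case: CA => [->|CA]; first by exists B; split => //; apply: sub0set.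
    have [AB|BA] := Ctot _ _ CA CB; first by exists B; split.
    by exists A; split.
  exists B'; split; first by right.
  move=> j; rewrite inE => /orP[/eqP->|/Aa]; first by right; apply: BB'.
  by move=> [?|/AB' ?]; [left|right].
have Aadm : admissible (S `|` A) by case: CA => [->|/Cadm //]; rewrite setU0.
by apply: Aadm; exists I, d, a; split => // i; apply: Aa; rewrite mem_enum.
Qed.

Lemma admissible_total S : normalized_CNP s -> admissible S ->
  exists S', [/\ S `<=` S', admissible S' & forall y f, exists g, S' (y, f, g)].
Proof.
move=> hs Sadm.
have [|A [Aadm Amax]] := @Zorn_bigcup _ [set A | admissible (S `|` A)].
  by move=> C CP Ctot; apply: admissible_chain.
exists (S `|` A); split => // y f.
have [g gP] := admissible_extend y f hs Aadm; exists g.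
have := Amax (A `|` [set (y, f, g)]); rewrite /= setUA => h.
apply: contrapT => nS; apply: h; last exact: admissible_setU1.
split; first by move=> ?; left.
by move=> sub; apply: nS; right; apply: sub; right.
Qed.

(** On a total admissible relation g is determined by (y, f), since
s_y (x) (g - g') has norm at most that of s_y (x) 0 and s(y,y) > 0. *)
Lemma admissible_graph S : normalized_CNP s -> admissible S ->
  exists2 gam : X -> F -> G, admissible [set a | gam a.1.1 a.1.2 = a.2] &
    forall y f g, S (y, f, g) -> gam y f = g.
Proof.
move=> hs /(admissible_total hs)[S' [SS' S'adm S'tot]].
have [gam gamP] := @choice _ _ (fun p g => S' (p.1, p.2, g))
  (fun p => S'tot p.1 p.2).
have uniq y f g : S' (y, f, g) -> gam (y, f) = g.
  move=> Sg; have /S'adm := kspan_lin (-1) (kspan_elem HsF HsG Sg)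
    (kspan_elem HsF HsG (gamP (y, f))).
  rewrite -!kvec_linear !scaleN1r addNr !nsq_kvec; try by case: hs.
  rewrite nsq0 mulr0 pmulr_rle0 ?cnp_diag_gt0 // => h.
  by apply/subr0_eq/nsq_eq0/eqP; rewrite addrC eq_le h nsq_ge0.
exists (fun y f => gam (y, f)); last by move=> y f g /SS' /uniq.
move=> u v [I [d [a [Sa uE vE]]]]; apply: S'adm; exists I, d, a; split => // i.
by have := gamP (a i).1; have := Sa i; rewrite /=; case: (a i) => [[y f] g] /= ->.
Qed.

Section Graph.
Context (gam : X -> F -> G) (hs : normalized_CNP s).
Context (gam_adm : admissible [set a | gam a.1.1 a.1.2 = a.2]).
Local Notation S := [set a | gam a.1.1 a.1.2 = a.2].

Lemma kspan_graph y f : kspan S (kvec HsF y f) (kvec HsG y (gam y f)).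
Proof. exact: kspan_elem. Qed.

Lemma graph_contractive y f : nsq (gam y f) <= nsq f.
Proof.
have [ks _ _ _] := hs; have := gam_adm (kspan_graph y f).
by rewrite !nsq_kvec // ler_pM2l // cnp_diag_gt0.
Qed.

Lemma graph_linear y : linear (gam y).
Proof.
move=> c f f'.
have := kspan_lin (-1) (kspan_graph y (c *: f + f'))
  (kspan_lin c (kspan_graph y f) (kspan_graph y f')).
move/gam_adm; rewrite -!kvec_linear !scaleN1r addNr !nsq_kvec; try by case: hs.
rewrite nsq0 mulr0 pmulr_rle0 ?cnp_diag_gt0 // => h.
apply/esym/subr0_eq/nsq_eq0/eqP.
by rewrite [_ - gam y _]addrC eq_le h nsq_ge0.
Qed.

Lemma graph_adjoint y : exists T : bop G F,
  forall f g, '[f, T g] = '[gam y f, g].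
Proof.
have h g : exists z, nsq z <= nsq g /\ forall f, '[f, z] = '[gam y f, g].
  have gl := graph_linear y.
  have [||f _ ->|z [zP zn _]] := @riesz R F (fun f x => x = '[gam y f, g]) (nsq g).
  - have -> : gam y 0 = 0 by have := gl (-1) 0 0; rewrite scaler0 add0r scaleN1r addNr.
    by rewrite (linear0l hdot).
  - by move=> c u v _ _ -> ->; rewrite gl dotDl dotZl.
  - have := nsq_ge0 (gam y f - g); rewrite nsqB /rdot.
    have := graph_contractive y f; lra.
  by exists z; split => // f; apply/esym/zP.
have [T TP] := choice h.
have Tb : bounded_linear T.
  split.
    move=> c g g'; apply: dot_ext => f; rewrite dotC [RHS]dotC; congr (_^*)%R.
    by rewrite dotDr dotZr !(TP _).2 dotDr dotZr.
  by exists 1 => g; rewrite mul1r ler_norm_nsq (TP g).1.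
by exists (BOp Tb) => f g; apply: (TP g).2.
Qed.

(** The vector w is the image of h under the adjoint of the contraction
s_y (x) f |-> s_y (x) gam_y(f); testing against s_y (x) f identifies w(y) with
Gamma(y) h(y). *)
Lemma graph_mult (Gamma : X -> bop G F) (h : HsG) :
    (forall y f g, '[f, Gamma y g] = '[gam y f, g]) ->
  exists2 w : HsF, nsq w <= nsq h &
    forall y, rt_ev HsF w y = Gamma y (rt_ev HsG h y).
Proof.
move=> GammaE.
have [||u _ [v [k ->]]|w [wP wn _]] :=
  @riesz R HsF (fun u x => exists v, kspan S u v /\ x = '[v, h]) (nsq h).
- by exists 0; split; [exact: kspan0 | rewrite (linear0l hdot)].
- move=> c u v _ _ [u' [k ->]] [v' [k' ->]]; exists (c *: u' + v').
  by split; [exact: kspan_lin | rewrite dotDl dotZl].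
- by have := nsq_ge0 (v - h); rewrite nsqB /rdot; have := gam_adm k; lra.
exists w => // y; apply: dot_ext => f.
rewrite -dot_kvec dotC -(wP _ '[kvec HsG y (gam y f), h]); last first.
  by exists (kvec HsG y (gam y f)); split => //; apply: kspan_graph.
by rewrite -dotC dot_kvec dotC -GammaE -dotC.
Qed.

End Graph.
End Maximal.

Lemma mult_opP (R : realType) (X : Type) (l k : X -> X -> R[i])
    (Hl : rkhs l) (Hk : rkhs k) (F E : hilbertType R)
    (HlF : rkhs_tensor Hl F) (HkE : rkhs_tensor Hk E) (Phi : X -> bop F E) f x :
  Mult HlF HkE Phi ->
  rt_ev HkE (mult_op HlF HkE Phi f) x = Phi x (rt_ev HlF f x).
Proof.
move=> PhiM; rewrite /mult_op; case: xgetP => [_ _ /(_ x)//|nex].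
by have [g gP] := PhiM f; have := nex g.
Qed.

(** Leech factorization.  The hypothesis says that
(Phi(x) Phi(y)^* - Psi(x) Psi(y)^* ) s(x,y) is a positive kernel; the adjoints
are described by their defining property. *)
Lemma leech (R : realType) (X : Type) (s : X -> X -> R[i]) (Hs : rkhs s)
    (E F G : hilbertType R)
    (HsF : rkhs_tensor Hs F) (HsG : rkhs_tensor Hs G)
    (Phi : X -> bop F E) (Psi : X -> bop G E) :
    normalized_CNP s ->
    admissible HsF HsG [set a | exists e,
      (forall f, '[Phi a.1.1 f, e] = '[f, a.1.2]) /\
      (forall g, '[Psi a.1.1 g, e] = '[g, a.2])] ->
  exists Gamma : X -> bop G F,
    contractive_mult HsG HsF Gamma /\
    forall x, Psi x = Phi x \o Gamma x :> (G -> E).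
Proof.
move=> hs /(admissible_graph hs)[gam gam_adm gamE].
have [Gamma GammaP] := choice (graph_adjoint hs gam_adm).
have GM : Mult HsG HsF Gamma.
  by move=> h; have [w _ wP] := graph_mult gam_adm h GammaP; exists w.
exists Gamma; split; first split => //.
  split.
    move=> c f g; apply: (@rt_ev_inj _ _ _ _ _ HsF); apply/funext => x.
    rewrite evP !mult_opP // evP.
    by have [/(_ c) -> _] := bopP (Gamma x).
  move=> h; have [w wh wP] := graph_mult gam_adm h GammaP.
  rewrite ler_norm_nsq (_ : mult_op _ _ _ _ = w) //.
  by apply: (@rt_ev_inj _ _ _ _ _ HsF); apply/funext => x; rewrite mult_opP.
move=> x; apply/funext => g /=; apply: dot_ext => e.
have [f fP] := adjoint_vector e (bopP (Phi x)).
have [g' gP] := adjoint_vector e (bopP (Psi x)).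
have gf : gam x f = g' by apply: gamE; exists e.
by rewrite gP fP dotC [RHS]dotC GammaP gf.
Qed.

Theorem theorem2p4 (R : realType) (X : Type) (k l s : X -> X -> R[i])
    (hk : is_kernel k) (hl : is_kernel l) (hs : normalized_CNP s)
    (Hk : rkhs k) (Hl : rkhs l) (Hs : rkhs s)
    (E : hilbertType R) (HkE : rkhs_tensor Hk E) (HlE : rkhs_tensor Hl E)
    (M : set HkE) (N : set HlE)
    (hM : closed_subspace M) (hN : closed_subspace N)
    (hM0 : M <> [set 0]) (hN0 : N <> [set 0])
    (hNM : contractively_contained N M)
    (F G : hilbertType R)
    (HsF : rkhs_tensor Hs F) (HsG : rkhs_tensor Hs G)
    (Phi : X -> bop F E) (Psi : X -> bop G E)
    (hPhi : partially_isometric_mult HsF HkE Phi)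
    (hPsi : partially_isometric_mult HsG HlE Psi)
    (hMPhi : M = range (mult_op HsF HkE Phi))
    (hNPsi : N = range (mult_op HsG HlE Psi)) :
  exists Gamma : X -> bop G F,
    contractive_mult HsG HsF Gamma /\
    forall x, Psi x = Phi x \o Gamma x :> (G -> E).
Proof.
apply: leech => // u v [I [c [a [Sa uE vE]]]].
have [e eP] := choice Sa.
have [PhiM PhiI] := hPhi; have [PsiM PsiI] := hPsi.
(* <h, u> and <h, v> depend on h only through M_Phi h and M_Psi h, and by the
   same functional L of these E-valued functions.  Thus |v|^2 = L(M_Psi v), and
   M_Psi v, being an element of N and hence of M, equals M_Phi h for some h
   with |h| <= |v|; this gives |v|^2 = <h, u>. *)
pose L (w : X -> E) := \sum_i (c i)^*%R * '[w (a i).1.1, e i].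
have Lu h : '[h, u] = L (rt_ev HkE (mult_op HsF HkE Phi h)).
  rewrite uE dot_sumr; apply: eq_bigr => i _.
  by rewrite dotZr dot_kvec mult_opP // (eP i).1.
have Lv h : '[h, v] = L (rt_ev HlE (mult_op HsG HlE Psi h)).
  rewrite vE dot_sumr; apply: eq_bigr => i _.
  by rewrite dotZr dot_kvec mult_opP // (eP i).2.
pose n := mult_op HsG HlE Psi v.
(* v is orthogonal to the kernel of M_Psi, since <w, v> = L(M_Psi w). *)
have nv : nsq n = nsq v.
  apply: complexI; rewrite -!norm_nsq PsiI.2 // => w Tw.
  rewrite dotC Lv Tw /L big1 ?conjC0 // => i _.
  by rewrite linear0 /= (linear0l hdot) mulr0.
have Nn : N n by rewrite hNPsi; exists v.
have [m Mm mn] : [set rt_ev HkE f | f in M] (rt_ev HlE n).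
  by apply: hNM.1; exists n.
have := Mm; rewrite {1}hMPhi => -[h0 _ h0m].
have [h hm hnsq] := partial_isometry_lift h0 PhiI.
have := hNM.2 _ _ Nn Mm mn; rewrite ler_norm_nsq => mlen.
have vh : nsq v = rdot h u.
  by rewrite /rdot Lu hm h0m mn -Lv.
have := nsq_ge0 (h - u); rewrite nsqB -vh hnsq h0m; lra.
Qed.
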